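(* Let $a,b,p$ be complex numbers, and let $(U_n)_{n\ge 0}$, $(V_n)_{n\ge 0}$ be the sequences defined by $U_0=0$, $U_1=1$, $V_0=2$, $V_1=p$ and $U_n=pU_{n-1}-U_{n-2}$, $V_n=pV_{n-1}-V_{n-2}$ for $n\ge 2$. Let $W_n=aU_n+bV_n$ for $n\ge 0$ and $\Omega=a^2+4b^2-b^2p^2$. Then for all integers $m,n\ge 0$ and every integer $k\ge 1$, $$W_n^{2k}+W_{n+m}^{2k}=\sum_{r=0}^{k}\theta_{k,r}(m)\,\Omega^{k-r}\,W_n^r\,W_{n+m}^r,$$ where $$\theta_{k,r}(m)=\sum_{0\le 2j\le k}(-1)^j\frac{k\,(k-j-1)!}{j!\,(k-r)!\,(r-2j)!}\,V_m^{r-2j}\,U_m^{2k-2r},$$ the sum being over integers $j$ with $0\le 2j\le k$.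
   Context: Conventions: in the sum defining $\theta_{k,r}(m)$, any term with $2j>r$ is interpreted as $0$ (i.e. $1/N!=0$ for negative integers $N$). Any zeroth power, including $0^0$, equals $1$. *)

(* Defs.v *)
From mathcomp Require Import all_boot all_order all_algebra.
Set Implicit Arguments.
Unset Strict Implicit.
Unset Printing Implicit Defensive.

Import GRing.Theory.
Local Open Scope ring_scope.

Fixpoint lucasU (F : fieldType) (p : F) (n : nat) : F :=
  match n with
  | 0%N => 0
  | n1.+1 => match n1 with
             | 0%N => 1
             | n2.+1 => p * lucasU p n1 - lucasU p n2
             end
  end.

Fixpoint lucasV (F : fieldType) (p : F) (n : nat) : F :=
  match n with
  | 0%N => 2%:R
  | n1.+1 => match n1 with
             | 0%N => p
             | n2.+1 => p * lucasV p n1 - lucasV p n2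
             end
  end.

Definition lucasW (F : fieldType) (a b p : F) (n : nat) : F :=
  a * lucasU p n + b * lucasV p n.

Definition lucasOmega (F : fieldType) (a b p : F) : F :=
  a ^+ 2 + 4%:R * b ^+ 2 - b ^+ 2 * p ^+ 2.

(* Only meant for r <= k and 1 <= k: the truncated differences k - r and
   k - j - 1 are then genuine ones whenever 2j <= k. The explicit test on
   2j <= r encodes the convention 1 / N! = 0 for N < 0. *)
Definition theta (F : fieldType) (p : F) (k r m : nat) : F :=
  \sum_(j < k.+1 | (2 * j <= k)%N)
    if (2 * j <= r)%N then
      (-1) ^+ j
      * ((k * (k - j - 1)`!)%:R / (j`! * (k - r)`! * (r - 2 * j)`!)%:R)
      * lucasV p m ^+ (r - 2 * j) * lucasU p m ^+ (2 * k - 2 * r)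
    else 0.

(* Main.v *)
Require Import Defs.
From mathcomp Require Import all_boot all_order all_algebra.
From mathcomp Require Import reals complex.
From mathcomp Require Import ring zify.

(** Write [x] for W_n, [y] for W_(n+m) and [z] for [x * y].  The terms x and y
    lie on a conic,

      x^2 + y^2 = Omega U_m^2 + V_m z        ([lucasW_sum_sqr]),

    which comes from the addition formula for W and from the invariance of the
    quadratic form W_(n+1)^2 - p W_(n+1) W_n + W_n^2 along the recurrence
    (its constant value is Omega).  On the other hand, A^k + B^k is a polynomial
    in A + B and A B, given by Waring's formula ([waring])

      A^k + B^k = sum_(2j <= k) (-1)^j k (k-j-1)! / (j! (k-2j)!)
                                (A + B)^(k-2j) (A B)^j.

    For A = x^2 and B = y^2, the sum A + B is affine in z by the conic equation,
    while A B = z^2.  Expanding (A + B)^(k-2j) by the binomial theorem and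
    collecting the powers of z, the i-th term of the j-th binomial contributes to
    z^r with r = i + 2j, and the product of the Waring coefficient with the
    binomial coefficient simplifies to k (k-j-1)! / (j! (k-r)! (r-2j)!), the
    coefficient in theta ([waring_term_expand]). *)

Import GRing.Theory.
Local Open Scope ring_scope.

Section Recurrences.
Context {F : fieldType} (a b p : F).

Local Notation U := (lucasU p).
Local Notation V := (lucasV p).
Local Notation W := (lucasW a b p).

Lemma lucasUSS n : U n.+2 = p * U n.+1 - U n. Proof. by []. Qed.

Lemma lucasVSS n : V n.+2 = p * V n.+1 - V n. Proof. by []. Qed.

Lemma lucasWSS n : W n.+2 = p * W n.+1 - W n.
Proof. by rewrite /lucasW lucasUSS lucasVSS; ring. Qed.

(** The familiar V_m = U_(m+1) - U_(m-1), with U_(m-1) replaced by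
    p U_m - U_(m+1) to avoid a separate case m = 0. *)
Lemma lucasV_U m : V m = 2%:R * U m.+1 - p * U m.
Proof.
suff [] : V m = 2%:R * U m.+1 - p * U m
       /\ V m.+1 = 2%:R * U m.+2 - p * U m.+1 by [].
elim: m => [|m [IH0 IH1]]; first by split; rewrite /=; ring.
split; first exact: IH1.
by rewrite lucasVSS IH1 IH0 !lucasUSS; ring.
Qed.

(** The factor of W_n is - U_(m-1), written so that it makes sense at m = 0.
    Both sides satisfy the recurrence in m, so two consecutive values are carried
    through the induction. *)
Lemma lucasW_add n m : W (n + m) = U m * W n.+1 + (U m.+1 - p * U m) * W n.
Proof.
suff [] : W (n + m) = U m * W n.+1 + (U m.+1 - p * U m) * W n
       /\ W (n + m).+1
          = U m.+1 * W n.+1 + (U m.+2 - p * U m.+1) * W n by [].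
elim: m => [|m [IH0 IH1]]; first by rewrite addn0 /=; split; ring.
rewrite addnS; split; first exact: IH1.
by rewrite lucasWSS IH1 IH0 !lucasUSS; ring.
Qed.

End Recurrences.

(** The quadratic form X^2 - p X Y + Y^2 is preserved by the recurrence step
    (X, Y) |-> (p X - Y, X), so its value is the one at n = 0. *)
Lemma lucasW_cassini {F : fieldType} (a b p : F) n :
  lucasW a b p n.+1 ^+ 2 - p * lucasW a b p n.+1 * lucasW a b p n
    + lucasW a b p n ^+ 2
  = lucasOmega a b p.
Proof.
elim: n => [|n <-]; last by rewrite lucasWSS; ring.
by rewrite /lucasW /lucasOmega /=; ring.
Qed.

Lemma lucasU_cassini {F : fieldType} (p : F) m :
  lucasU p m.+1 ^+ 2 - p * lucasU p m.+1 * lucasU p m + lucasU p m ^+ 2 = 1.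
Proof.
have WU i : lucasW 1 0 p i = lucasU p i by rewrite /lucasW mul1r mul0r addr0.
have := lucasW_cassini 1 0 p m; rewrite !WU => ->.
by rewrite /lucasOmega; ring.
Qed.

(** Put x = W_n and y = W_(n+m).  With y = U_m W_(n+1) + (U_(m+1) - p U_m) x, V_m
    eliminated in favour of U, and Omega written as the quadratic form at index n,
    the defect of this identity is x^2 times the defect of the Cassini identity
    for U. *)
Lemma lucasW_sum_sqr {F : fieldType} (a b p : F) m n :
  lucasW a b p n ^+ 2 + lucasW a b p (n + m) ^+ 2
  = lucasOmega a b p * lucasU p m ^+ 2
    + lucasV p m * (lucasW a b p n * lucasW a b p (n + m)).
Proof.
rewrite -(lucasW_cassini a b p n) lucasW_add lucasV_U.
apply/eqP; rewrite -subr_eq0; apply/eqP.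
set x := lucasW a b p n; set z := lucasW a b p n.+1.
transitivity (x ^+ 2 * (1 - (lucasU p m.+1 ^+ 2
  - p * lucasU p m.+1 * lucasU p m + lucasU p m ^+ 2))); first by ring.
by rewrite lucasU_cassini subrr mulr0.
Qed.

Section Waring.
Context {F : fieldType}.
Hypothesis F0 : [pchar F] =i pred0.

Let natr_neq0 n : (0 < n)%N -> n%:R != 0 :> F.
Proof. by rewrite (iffLR (pcharf0P F) F0) -lt0n. Qed.

Let fact_neq0 n : n`!%:R != 0 :> F.
Proof. by rewrite natr_neq0 ?fact_gt0. Qed.

Definition waring_coef (k j : nat) : F :=
  (k * (k - j - 1)`!)%:R / (j`! * (k - 2 * j)`!)%:R.

Lemma waring_coef0 k : (0 < k)%N -> waring_coef k 0 = 1.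
Proof.
case: k => // k _; rewrite /waring_coef !subn0 subn1 /=.
by rewrite -factS fact0 mul1n divff ?fact_neq0.
Qed.

(** The diagonal value at j = 0 would be 0 instead of 2: with k = 0 the factor
    k makes the formula degenerate, so the power sum of exponent 0 cannot serve as
    a base case of Waring's formula and the exponents start at 1. *)
Lemma waring_coef_double j : (0 < j)%N -> waring_coef (2 * j) j = 2%:R.
Proof.
case: j => // j _; rewrite /waring_coef subnn fact0 muln1.
have -> : (2 * j.+1 - j.+1 - 1 = j)%N by lia.
by rewrite -mulnA -factS natrM mulfK ?fact_neq0.
Qed.

(** After the substitution k = 2j + e + 1 all differences become sums, and
    clearing factorials leaves a polynomial identity in j and e. *)
Lemma waring_coef_rec k j : (2 * j < k)%N ->
  waring_coef k.+2 j.+1 = waring_coef k.+1 j.+1 + waring_coef k j.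
Proof.
move=> lt_jk; pose e := (k - 2 * j - 1)%N.
have -> : k = (2 * j + e).+1 by lia.
rewrite /waring_coef.
have -> : ((2 * j + e).+3 - j.+1 - 1 = (j + e).+1)%N by lia.
have -> : ((2 * j + e).+2 - j.+1 - 1 = j + e)%N by lia.
have -> : ((2 * j + e).+3 - 2 * j.+1 = e.+1)%N by lia.
have -> : ((2 * j + e).+2 - 2 * j.+1 = e)%N by lia.
have -> : ((2 * j + e).+1 - 2 * j = e.+1)%N by lia.
rewrite !factS !natrM.
have := fact_neq0 j; have := fact_neq0 e.
have := natr_neq0 _ (ltn0Sn j); have := natr_neq0 _ (ltn0Sn e).
rewrite -!natr1 !natrD => e1 j1 ef jf.
by field; rewrite e1 j1 ef jf.
Qed.

Definition waring_term (A B : F) k j :=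
  if (2 * j <= k)%N
  then (-1) ^+ j * waring_coef k j * (A + B) ^+ (k - 2 * j) * (A * B) ^+ j
  else 0.

Lemma waring_term0 A B k : (0 < k)%N -> waring_term A B k 0 = (A + B) ^+ k.
Proof.
by move=> k_gt0; rewrite /waring_term muln0 leq0n waring_coef0 // subn0 !expr0; ring.
Qed.

(** The recurrence S_(k+2) = (A + B) S_(k+1) - A B S_k of the power sums holds
    term by term once the last summand is shifted.  At the top index 2j = k the
    middle term is absent and both remaining coefficients are 2. *)
Lemma waring_term_rec A B k j : (0 < k)%N ->
  waring_term A B k.+2 j.+1
  = (A + B) * waring_term A B k.+1 j.+1 - A * B * waring_term A B k j.
Proof.
move=> k_gt0; rewrite /waring_term.
have -> : (2 * j.+1 <= k.+2)%N = (2 * j <= k)%N by lia.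
have -> : (2 * j.+1 <= k.+1)%N = (2 * j < k)%N by lia.
have -> : (k.+2 - 2 * j.+1 = k - 2 * j)%N by lia.
case: (ltngtP (2 * j) k) => [lt_jk|_|eq_jk]; last 2 first.
- by rewrite !mulr0 subrr.
- rewrite -eq_jk subnn.
  have -> : ((2 * j).+2 = 2 * j.+1)%N by lia.
  by rewrite !waring_coef_double ?exprS; [ring | lia | lia].
rewrite waring_coef_rec //.
have -> : (k - 2 * j = (k.+1 - 2 * j.+1).+1)%N by lia.
by rewrite !exprS; ring.
Qed.

(** The number N of terms is free, as long as it covers all j with 2j <= k: the
    three sums of the recurrence can then be taken over matching ranges. *)
Lemma waring A B k N : (0 < k)%N -> (k < 2 * N)%N ->
  A ^+ k + B ^+ k = \sum_(j < N) waring_term A B k j.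
Proof.
(* M bounds k: the induction step calls the hypothesis at k - 1 and k - 2. *)
suff H M : (k < M)%N -> (0 < k)%N -> (k < 2 * N)%N ->
    A ^+ k + B ^+ k = \sum_(j < N) waring_term A B k j by exact: (H k.+1).
elim: M k N => // M IH k [|N] lt_kM k_gt0 lt_kN; first by lia.
have out k' i : (k' < 2 * i)%N -> waring_term A B k' i = 0.
  by rewrite /waring_term ltnNge => /negbTE ->.
rewrite big_ord_recl waring_term0 //.
case: k lt_kM k_gt0 lt_kN => [//|[|[|k]]] lt_kM _ lt_kN.
- by rewrite big1 ?addr0 ?expr1 // => i _; rewrite out //= /bump /=; lia.
- case: N lt_kN => [|N] lt_kN; first by lia.
  rewrite big_ord_recl big1 => [|i _]; last by rewrite out //= /bump /=; lia.
  rewrite /bump /= /waring_term /= (waring_coef_double 1) //.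
  by rewrite subnn; ring.
under eq_bigr => i _ do rewrite waring_term_rec //.
rewrite sumrB -!mulr_sumr -IH //; [|lia|lia].
have := IH k.+2 N.+1; rewrite big_ord_recl waring_term0 // => H.
have {H}H := H ltac:(lia) isT ltac:(lia).
rewrite exprS -(addrC (- _)) addrCA -mulrDr -H !exprS; ring.
Qed.

(** Binomial expansion reindexed by r = i + 2j.  The factorial (k - 2j)! of the
    Waring coefficient cancels against the numerator of the binomial coefficient
    (k - 2j choose r - 2j). *)
Lemma waring_term_expand (c v z : F) k j : (2 * j <= k)%N ->
  (-1) ^+ j * waring_coef k j * (c + v * z) ^+ (k - 2 * j) * (z ^+ 2) ^+ j
  = \sum_(r < k.+1 | (2 * j <= r)%N)
      (-1) ^+ j
      * ((k * (k - j - 1)`!)%:R / (j`! * (k - r)`! * (r - 2 * j)`!)%:R)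
      * v ^+ (r - 2 * j) * c ^+ (k - r) * z ^+ r.
Proof.
move=> le_jk; rewrite -[RHS](big_geq_mkord _ _ xpredT (fun r =>
  (-1) ^+ j
  * ((k * (k - j - 1)`!)%:R / (j`! * (k - r)`! * (r - 2 * j)`!)%:R)
  * v ^+ (r - 2 * j) * c ^+ (k - r) * z ^+ r)) (big_addn 0 _ (2 * j)).
rewrite exprDn subSn // big_mkord mulr_sumr mulr_suml; apply: eq_bigr => i _.
have le_i : (i <= k - 2 * j)%N by rewrite -ltnS.
have -> : (k - (i + 2 * j) = k - 2 * j - i)%N by lia.
rewrite addnK exprMn exprD exprM /waring_coef -(bin_fact le_i) -mulr_natr.
have : 'C(k - 2 * j, i)%:R != 0 :> F by rewrite natr_neq0 ?bin_gt0.
have := fact_neq0 j; have := fact_neq0 i; have := fact_neq0 (k - 2 * j - i).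
rewrite !natrM -!exprM => f1 f2 f3 f4.
by field; rewrite f1 f2 f3 f4.
Qed.

(** The order of summation is exchanged so that the powers of x y are collected
    outside and their coefficients have the shape of theta. *)
Lemma waring_sqr (x y c v : F) k : (0 < k)%N ->
    x ^+ 2 + y ^+ 2 = c + v * (x * y) ->
  x ^+ (2 * k) + y ^+ (2 * k)
  = \sum_(r < k.+1)
      (\sum_(j < k.+1 | (2 * j <= k)%N)
         if (2 * j <= r)%N then
           (-1) ^+ j
           * ((k * (k - j - 1)`!)%:R / (j`! * (k - r)`! * (r - 2 * j)`!)%:R)
           * v ^+ (r - 2 * j) * c ^+ (k - r)
         else 0)
      * (x * y) ^+ r.
Proof.
move=> k_gt0 xy; rewrite !exprM (waring _ _ _ k.+1) //; last by lia.
under [RHS]eq_bigr => r _ do rewrite mulr_suml.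
rewrite [RHS]exchange_big /= [LHS](bigID (fun j : 'I__ => (2 * j <= k)%N)) /=.
rewrite [X in _ + X]big1 => [|j /negbTE]; last by rewrite /waring_term => ->.
rewrite addr0; apply: eq_bigr => j le_jk; rewrite /waring_term le_jk xy.
rewrite -exprMn waring_term_expand // big_mkcond; apply: eq_bigr => r _.
by case: ifP => _; rewrite ?mul0r.
Qed.

End Waring.

Theorem theorem1 (R : realType) (a b p : R[i]) (m n k : nat)
    (k_ge1 : (1 <= k)%N) :
  lucasW a b p n ^+ (2 * k) + lucasW a b p (n + m) ^+ (2 * k)
  = \sum_(r < k.+1)
      theta p k r m * lucasOmega a b p ^+ (k - r)
      * lucasW a b p n ^+ r * lucasW a b p (n + m) ^+ r.
Proof.
rewrite (waring_sqr (Num.Theory.pchar_num _) _ _ _ _ _ k_ge1 (lucasW_sum_sqr a b p m n)).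
apply: eq_bigr => r _; rewrite -[RHS]mulrA -exprMn; congr (_ * _).
rewrite /theta mulr_suml; apply: eq_bigr => j _.
case: ifP => _; last by rewrite mul0r.
by rewrite exprMn -exprM mulnBr; ring.
Qed.
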